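(* Let $(\mathbb F,\star)\in\{(\mathbb C,* ),(\mathbb R,\top)\}$. Let $n,m\in\mathbb N$, and let $q,\eta_1,\dots,\eta_q$ be arbitrary non-negative integers satisfying $$n-q\le m,\qquad \eta_1+\cdots+\eta_q\le n-q.$$ Then there exists a pencil $\lambda E-Q$ with $E,Q\in\mathbb F^{n,m}$ ($n$ rows, $m$ columns) satisfying $Q^\star E=E^\star Q\ge0$ with precisely $q$ left minimal indices $\eta_1,\dots,\eta_q$.
   Context: The left minimal indices of a pencil are the numbers $\eta\ge0$ of the blocks $\mathcal L_\eta^\top$ of size $(\eta+1)\times\eta$, where $\mathcal L_\eta=\lambda[I_\eta\ 0]-[0\ I_\eta]$, occurring in its Kronecker canonical form (a block with $\eta=0$ is a zero row). $*$ is conjugate transpose, $\top$ is transpose; $W\ge 0$ means Hermitian (real symmetric) positive semidefinite. *)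

(* Defs.v *)
From HB Require Import structures.
From mathcomp Require Import all_boot all_order all_algebra.
From mathcomp Require Import sesquilinear spectral.
From mathcomp Require Import complex reals.

Set Implicit Arguments.
Unset Strict Implicit.
Unset Printing Implicit Defensive.

Import Order.TTheory GRing.Theory Num.Theory.

Local Open Scope ring_scope.
Local Open Scope sesquilinear_scope.

(* [theta] is the conjugation of [F]: [Num.conj] for complex matrices and [id]
   for real ones, so that [M ^t theta] is M^* or M^T respectively. *)
Definition psdmx (F : numDomainType) (theta : F -> F) (n : nat)
    (W : 'M[F]_n) : Prop :=
  W ^t theta = W /\ forall x : 'cV[F]_n, 0 <= (x ^t theta *m W *m x) 0 0.

(* Matrix pencils are polynomial matrices, with 'X in the role of lambda. *)
Definition pencil (F : fieldType) (n m : nat) (E Q : 'M[F]_(n, m)) :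
    'M[{poly F}]_(n, m) :=
  'X *: map_mx polyC E - map_mx polyC Q.

Section KroneckerForm.

Variable F : closedFieldType.

(* The two regular blocks carry their size minus one, so that no canonical
   form contains an empty block; [KL 0] is a zero column and [KLT 0] a zero
   row. *)
Inductive kblock : Type :=
  | KL of nat
  | KLT of nat
  | KJ of nat & F
  | KN of nat.

Definition kblock_rows (b : kblock) : nat :=
  match b with
  | KL e => e
  | KLT e => e.+1
  | KJ k _ => k.+1
  | KN k => k.+1
  end.

Definition kblock_cols (b : kblock) : nat :=
  match b with
  | KL e => e.+1
  | KLT e => e
  | KJ k _ => k.+1
  | KN k => k.+1
  end.

(* lambda [I_e 0] - [0 I_e] *)
Definition Lpencil (e : nat) : 'M[{poly F}]_(e, e.+1) :=
  pencil (\matrix_(i, j) (i == j :> nat)%:R)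
         (\matrix_(i, j) (i.+1 == j :> nat)%:R).

Definition jordan_block (k : nat) (a : F) : 'M[F]_k :=
  \matrix_(i, j) (a *+ (i == j) + (i.+1 == j :> nat)%:R).

Definition kblock_mx (b : kblock) :
    'M[{poly F}]_(kblock_rows b, kblock_cols b) :=
  match b return 'M[{poly F}]_(kblock_rows b, kblock_cols b) with
  | KL e => Lpencil e
  | KLT e => (Lpencil e)^T
  | KJ k a => pencil 1%:M (jordan_block k.+1 a)
  | KN k => pencil (jordan_block k.+1 0) 1%:M
  end.

Fixpoint kdiag_rows (bs : seq kblock) : nat :=
  if bs is b :: bs' then (kblock_rows b + kdiag_rows bs')%N else 0%N.

Fixpoint kdiag_cols (bs : seq kblock) : nat :=
  if bs is b :: bs' then (kblock_cols b + kdiag_cols bs')%N else 0%N.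

Fixpoint kdiag (bs : seq kblock) :
    'M[{poly F}]_(kdiag_rows bs, kdiag_cols bs) :=
  match bs return 'M[{poly F}]_(kdiag_rows bs, kdiag_cols bs) with
  | [::] => 0
  | b :: bs' => block_mx (kblock_mx b) 0 0 (kdiag bs')
  end.

(* [bs] lists the blocks, in some order, of the Kronecker canonical form of
   [P]: S P T = diag(bs) for constant invertible S and T. *)
Definition kronecker_form (n m : nat) (P : 'M[{poly F}]_(n, m))
    (bs : seq kblock) : Prop :=
  exists (eqn : kdiag_rows bs = n) (eqm : kdiag_cols bs = m)
         (S : 'M[F]_n) (T : 'M[F]_m),
    [/\ S \in unitmx, T \in unitmx &
        map_mx polyC S *m P *m map_mx polyC T = castmx (eqn, eqm) (kdiag bs)].

Definition kblock_left_index (b : kblock) : option nat :=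
  if b is KLT e then Some e else None.

(* The left minimal indices are a multiset, hence the [perm_eq]. The
   Kronecker form being unique up to the order of its blocks, this determines
   [s] up to permutation. *)
Definition left_minimal_indices (n m : nat) (P : 'M[{poly F}]_(n, m))
    (s : seq nat) : Prop :=
  exists2 bs : seq kblock,
    kronecker_form P bs & perm_eq (pmap kblock_left_index bs) s.

End KroneckerForm.

(* Main.v *)
Require Import Defs.
From mathcomp Require Import all_boot all_order all_algebra.
From mathcomp Require Import sesquilinear spectral.
From mathcomp Require Import complex reals.
From mathcomp Require Import zify.

(** A pencil of the special shape [lambda E - D E], with [D] a nonnegative
    real diagonal matrix, always satisfies the required condition, because
    [E^* Q = E^* D E] is Hermitian positive semidefinite whatever [E] is
    ([psdmx_diag_sandwich]).  So it is enough to find such a pencil in the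
    strict equivalence class of a Kronecker form with the prescribed left
    minimal indices.

    The key case is a single block [L_e^T], which multiplies from the left
    by a row [(s_0, ..., s_e)] to [(lambda s_0 - s_1, ...,
    lambda s_(e-1) - s_e)].  On a row of powers [(1, t, ..., t^e)] this is
    [(lambda - t) (1, t, ..., t^(e-1))].  Hence for any [e+1] distinct
    nonnegative nodes [t_k] the Vandermonde matrix [S] of these rows is
    invertible and turns [L_e^T] into [(lambda - D) E], with [D = diag t_k]
    and [E] consisting of the first [e] columns of [S]
    ([diag_pencil_KLT]).  The nodes used are [0, 1, ..., e].

    The shape [lambda E - D E] is stable under direct sums, and it contains
    the [1 x 1] block [lambda] and the zero column.  The blocks
    [L_(eta_i)^T] occupy [q + eta_1 + ... + eta_q <= n] rows; the remaining
    [n - q - (eta_1 + ... + eta_q)] rows are filled by blocks [lambda], after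
    which exactly [m + q - n >= 0] columns are left, which are taken to be
    zero.

    All matrices [E] and [D] have real (indeed natural) entries, so that the
    same pair serves for both fields. *)

Import Order.TTheory GRing.Theory Num.Theory.

Local Open Scope ring_scope.
Local Open Scope complex_scope.
Local Open Scope sesquilinear_scope.

Set Implicit Arguments.
Unset Strict Implicit.
Unset Printing Implicit Defensive.

(** * Operations on pencils *)

Lemma mulmx_pencil (F : fieldType) (n m p : nat) (S : 'M[F]_(p, n))
    (E Q : 'M[F]_(n, m)) :
  map_mx polyC S *m pencil E Q = pencil (S *m E) (S *m Q).
Proof. by rewrite /pencil mulmxBr -scalemxAr !map_mxM. Qed.

Lemma trmx_pencil (F : fieldType) (n m : nat) (E Q : 'M[F]_(n, m)) :
  (pencil E Q)^T = pencil E^T Q^T.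
Proof. by rewrite /pencil linearB linearZ /= !map_trmx. Qed.

Lemma block_pencil (F : fieldType) (n1 n2 m1 m2 : nat)
    (E1 Q1 : 'M[F]_(n1, m1)) (E2 Q2 : 'M[F]_(n2, m2)) :
  block_mx (pencil E1 Q1) 0 0 (pencil E2 Q2) =
  pencil (block_mx E1 0 0 E2) (block_mx Q1 0 0 Q2).
Proof.
by rewrite /pencil !map_block_mx !map_mx0 scale_block_mx opp_block_mx
           add_block_mx !scaler0 !subr0.
Qed.

(** * Positive semidefiniteness *)

Lemma trmx_conjK (F : numDomainType) (theta : F -> F) (n m : nat)
    (M : 'M[F]_(n, m)) :
  involutive theta -> (M ^t theta) ^t theta = M.
Proof. by move=> thetaK; apply/matrixP=> i j; rewrite !mxE thetaK. Qed.

(** The two fields of the theorem differ only in the conjugation: [theta] is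
    [Num.conj] or the identity. *)
Lemma psdmx_diag_sandwich (F : numDomainType) (theta : {rmorphism F -> F})
    (n m : nat) (d : 'rV[F]_n) (E : 'M[F]_(n, m)) :
    involutive theta -> (forall y, 0 <= theta y * y) ->
    (forall k, theta (d 0 k) = d 0 k) -> (forall k, 0 <= d 0 k) ->
  psdmx theta (E ^t theta *m (diag_mx d *m E)).
Proof.
move=> thetaK theta_ge0 theta_d d_ge0.
have theta_diag : diag_mx d ^t theta = diag_mx d.
  by rewrite tr_diag_mx map_diag_mx; congr diag_mx; apply/rowP=> k; rewrite mxE.
split.
  by rewrite !trmx_mul !map_mxM theta_diag trmx_conjK ?mulmxA.
move=> x.
have -> : x ^t theta *m (E ^t theta *m (diag_mx d *m E)) *m x =
          (E *m x) ^t theta *m (diag_mx d *m (E *m x)).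
  by rewrite trmx_mul map_mxM !mulmxA.
rewrite mul_diag_mx mxE sumr_ge0 // => k _.
by rewrite !mxE mulrCA mulr_ge0.
Qed.

(** * Pencils equivalent to lambda E - D E *)

(** The coefficients live in the subfield [K] of [C], since the real case of
    the theorem asks for real matrices and a Kronecker form over the complex
    numbers. *)
Definition diag_pencil (K : numFieldType) (C : closedFieldType)
    (f : {rmorphism K -> C}) (n m : nat) (P : 'M[{poly C}]_(n, m)) : Prop :=
  exists (E : 'M[K]_(n, m)) (d : 'rV[K]_n) (S : 'M[C]_n),
    [/\ forall k, 0 <= d 0 k, S \in unitmx &
        map_mx polyC S *m P =
        pencil (map_mx f E) (map_mx f (diag_mx d *m E))].

Section DiagPencil.

Variables (K : numFieldType) (C : closedFieldType) (f : {rmorphism K -> C}).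

Lemma diag_pencil_pencil (n m : nat) (E : 'M[K]_(n, m)) (d : 'rV[K]_n) :
    (forall k, 0 <= d 0 k) ->
  diag_pencil f (pencil (map_mx f E) (map_mx f (diag_mx d *m E))).
Proof.
move=> d_ge0; exists E, d, 1%:M; split=> //; first exact: unitmx1.
by rewrite map_mx1 mul1mx.
Qed.

Lemma diag_pencil_block (n1 n2 m1 m2 : nat) (P1 : 'M[{poly C}]_(n1, m1))
    (P2 : 'M[{poly C}]_(n2, m2)) :
  diag_pencil f P1 -> diag_pencil f P2 ->
  diag_pencil f (block_mx P1 0 0 P2).
Proof.
move=> [E1 [d1 [S1 [d1_ge0 S1u eq1]]]] [E2 [d2 [S2 [d2_ge0 S2u eq2]]]].
exists (block_mx E1 0 0 E2), (row_mx d1 d2), (block_mx S1 0 0 S2); split.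
- by move=> k; rewrite mxE; case: split.
- by rewrite unitmxE det_ublock unitrM -!unitmxE S1u.
rewrite diag_mx_row !(map_block_mx, mulmx_block) !map_mx0.
by rewrite !(mulmx0, mul0mx, addr0, add0r) eq1 eq2 block_pencil !map_mx0.
Qed.

(** The equivalence is by the transposed Vandermonde matrix, whose rows are
    [(1, t, ..., t^e)].  The nodes [0, ..., e] are nonnegative, as the diagonal
    must be, and pairwise distinct because [K], being ordered, has
    characteristic zero. *)
Lemma diag_pencil_KLT (e : nat) : diag_pencil f (kblock_mx (KLT C e)).
Proof.
pose t : 'rV[C]_e.+1 := \row_k k%:R.
pose S := (Vandermonde e.+1 t)^T.
exists (\matrix_(k, i) k%:R ^+ i), (\row_k k%:R), S; split.
- by move=> k; rewrite mxE ler0n.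
- rewrite /S unitmx_tr unitmxE det_Vandermonde unitfE.
  apply/prodf_neq0=> i _; apply/prodf_neq0=> j lt_ij.
  rewrite !mxE -!(rmorph_nat f) -rmorphB fmorph_eq0 subr_eq0 eqr_nat.
  by rewrite neq_ltn lt_ij orbT.
rewrite /= /Lpencil trmx_pencil mulmx_pencil; congr pencil.
- (* Column [i] of [[I 0]^T] selects [t^i]. *)
  apply/matrixP=> k i; rewrite !mxE (bigD1 (widen_ord (leqnSn e) i)) //=.
  rewrite !mxE eqxx mulr1 big1 ?addr0 ?rmorphXn ?rmorph_nat // => j ne_ji.
  by rewrite !mxE eq_sym (negPf (ne_ji : j != i :> nat)) mulr0.
(* Column [i] of [[0 I]^T] selects [t^(i+1) = t * t^i]: the index shift of the
   block becomes multiplication of row [k] by its node. *)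
rewrite mul_diag_mx.
apply/matrixP=> k i; rewrite !mxE (bigD1 (lift ord0 i)) //=.
rewrite !mxE eqxx mulr1 big1 ?addr0 => [|j ne_ji].
  by rewrite -exprS rmorphXn rmorph_nat.
by rewrite !mxE eq_sym (negPf (ne_ji : j != i.+1 :> nat)) mulr0.
Qed.

Lemma diag_pencil_KJ0 : diag_pencil f (kblock_mx (KJ 0 (0 : C))).
Proof.
have -> : kblock_mx (KJ 0 (0 : C)) =
    pencil (map_mx f (1%:M : 'M_1)) (map_mx f (diag_mx 0 *m (1%:M : 'M_1))).
  rewrite /= map_mx1 linear0 mul0mx map_mx0; congr pencil.
  by apply/matrixP=> i j; rewrite !ord1 !mxE /= mul0rn addr0.
by apply: diag_pencil_pencil => k; rewrite mxE.
Qed.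

Lemma diag_pencil_KL0 : diag_pencil f (kblock_mx (KL C 0)).
Proof.
have -> : kblock_mx (KL C 0) =
    pencil (map_mx f (0 : 'M_(0, 1))) (map_mx f (diag_mx 0 *m (0 : 'M_(0, 1)))).
  by apply/matrixP; case.
by apply: diag_pencil_pencil; case.
Qed.

(** * Kronecker forms with prescribed left minimal indices *)

Definition left_index_blocks (s : seq nat) (r c : nat) : seq (kblock C) :=
  map (KLT C) s ++ nseq r (KJ 0 0) ++ nseq c (KL C 0).

Lemma diag_pencil_left_index_blocks (s : seq nat) (r c : nat) :
  diag_pencil f (kdiag (left_index_blocks s r c)).
Proof.
rewrite /left_index_blocks; elim: s => [|e s IHs] /=; last first.
  by apply: diag_pencil_block IHs; apply: diag_pencil_KLT.
elim: r => [|r IHr] /=; last first.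
  by apply: diag_pencil_block IHr; apply: diag_pencil_KJ0.
elim: c => [|c IHc] /=; last first.
  by apply: diag_pencil_block IHc; apply: diag_pencil_KL0.
exists 0, 0, 0; split; first by case.
  by rewrite unitmxE det_mx00 unitr1.
by apply/matrixP; case.
Qed.

Lemma kdiag_rows_left_index_blocks (s : seq nat) (r c : nat) :
  kdiag_rows (left_index_blocks s r c) = (sumn s + size s + r)%N.
Proof.
rewrite /left_index_blocks; elim: s => [|e s IHs] /=; last by rewrite IHs; lia.
by elim: r => [|r IHr] /=; [elim: c | rewrite IHr; lia].
Qed.

Lemma kdiag_cols_left_index_blocks (s : seq nat) (r c : nat) :
  kdiag_cols (left_index_blocks s r c) = (sumn s + r + c)%N.
Proof.
rewrite /left_index_blocks; elim: s => [|e s IHs] /=; last by rewrite IHs; lia.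
elim: r => [|r IHr] /=; last by rewrite IHr; lia.
by elim: c => [|c IHc] //=; rewrite IHc; lia.
Qed.

Lemma left_indices_left_index_blocks (s : seq nat) (r c : nat) :
  pmap (@kblock_left_index C) (left_index_blocks s r c) = s.
Proof.
rewrite /left_index_blocks; elim: s => [|e s IHs] /=; last by rewrite IHs.
by elim: r => [|r IHr] //=; elim: c.
Qed.

Lemma diag_pencil_with_left_indices (n m : nat) (s : seq nat) :
    (sumn s + size s <= n)%N -> (n <= m + size s)%N ->
  exists (E : 'M[K]_(n, m)) (d : 'rV[K]_n),
    (forall k, 0 <= d 0 k) /\
    left_minimal_indices
      (pencil (map_mx f E) (map_mx f (diag_mx d *m E))) s.
Proof.
move=> le_sn le_nm.
pose bs := left_index_blocks s (n - (sumn s + size s)) (m + size s - n).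
have eqn : kdiag_rows bs = n by rewrite kdiag_rows_left_index_blocks; lia.
have eqm : kdiag_cols bs = m by rewrite kdiag_cols_left_index_blocks; lia.
case: _ / eqn; case: _ / eqm.
case: (diag_pencil_left_index_blocks s (n - (sumn s + size s))
         (m + size s - n)) => E [d [S [d_ge0 S_unit eqS]]].
exists E, d; split=> //; exists bs; last first.
  by rewrite left_indices_left_index_blocks.
exists erefl, erefl, (invmx S), 1%:M.
split; [by rewrite unitmx_inv | exact: unitmx1 |].
rewrite -eqS castmx_id map_mx1 mulmx1 mulmxA -map_mxM mulVmx //.
by rewrite map_mx1 mul1mx.
Qed.

End DiagPencil.

Unset Implicit Arguments.

Theorem corollary17 (R : realType) (n m q : nat) (eta : q.-tuple nat)
    (hnm : n%:Z - q%:Z <= m%:Z)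
    (heta : \sum_(i < q) (tnth eta i)%:Z <= n%:Z - q%:Z) :
  (exists E Q : 'M[R[i]]_(n, m),
     [/\ Q ^t* *m E = E ^t* *m Q,
         psdmx Num.conj (E ^t* *m Q) &
         left_minimal_indices (pencil E Q) eta])
  /\
  (exists E Q : 'M[R]_(n, m),
     [/\ Q^T *m E = E^T *m Q,
         psdmx id (E^T *m Q) &
         left_minimal_indices
           (pencil (map_mx (real_complex R) E) (map_mx (real_complex R) Q))
           eta]).
Proof.
have sum_eta : \sum_(i < q) (tnth eta i)%:Z = (sumn eta)%:Z.
  rewrite sumnE big_tuple; elim/big_ind2: _ => // x1 x2 y1 y2 -> ->.
  by rewrite PoszD.
have le_n : (sumn eta + size eta <= n)%N.
  by move: heta; rewrite sum_eta size_tuple; lia.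
have le_nm : (n <= m + size eta)%N by move: hnm; rewrite size_tuple; lia.
have [E [d [d_ge0 lmi]]] :=
  @diag_pencil_with_left_indices R R[i] (real_complex R) n m eta le_n le_nm.
split.
- pose Ec := map_mx (real_complex R) E.
  pose dc := map_mx (real_complex R) d.
  have dc_ge0 k : 0 <= dc 0 k by rewrite mxE ler0c.
  have psd : psdmx Num.conj (Ec ^t* *m (diag_mx dc *m Ec)).
    apply: psdmx_diag_sandwich => // [|y|k].
    + exact: conjCK.
    + by rewrite mulrC mul_conjC_ge0.
    + by apply: CrealP; apply: ger0_real.
  exists Ec, (diag_mx dc *m Ec); split=> //; last first.
    by rewrite /dc -map_diag_mx -map_mxM.
  case: psd => <- _; rewrite [in RHS]trmx_mul [in RHS]map_mxM trmx_conjK //.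
  exact: conjCK.
have psd : psdmx id (E ^t id *m (diag_mx d *m E)).
  apply: (@psdmx_diag_sandwich R idfun) => // y.
  by rewrite -expr2 sqr_ge0.
rewrite map_mx_id in psd => //.
exists E, (diag_mx d *m E); split=> //.
by case: psd => <- _; rewrite map_mx_id // [in RHS]trmx_mul trmxK.
Qed.
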